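(* Let $\ell\ge2$, let $A\in\mathbb Z^{\ell\times r}$ and ${\bf L}\in(\mathbb C^* )^r$ be the matrix and vector defined in the context. Then there exists a data vector ${\bf u}\in\mathbb R^r$ such that the homogeneous Einstein equations $$\frac{L_{iii}'}{x_i}+\sum_{k\in[\ell]\setminus\{i\}}\Big(\frac{2L_{iik}x_k}{x_i^2}-\frac{L_{ikk}x_i}{x_k^2}\Big)+\sum_{\{j,k\}\subset[\ell]\setminus\{i\},\,j\ne k}2L_{ijk}\Big(\frac{x_k}{x_ix_j}+\frac{x_j}{x_ix_k}-\frac{x_i}{x_jx_k}\Big)+4d_i=0,\qquad 1\le i\le\ell,$$ are the (parametric) critical equations of the maximum likelihood estimation problem with data ${\bf u}$, $$\text{maximize}\quad\sum_{i=1}^ru_i\log(p_i)-u_+\log(p_+)\quad\text{subject to}\quad(p_1:\dots:p_r)\in V_{A,{\bf L}},$$ on the scaled toric variety $V_{A,{\bf L}}\subset\mathbb P_{\mathbb C}^{r-1}$.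
   Context: Parameters: positive real $d_i$, real $b_i$ ($i\in[\ell]=\{1,\dots,\ell\}$), and $L_{ijk}$ symmetric in $i,j,k\in[\ell]$; ${\bf d}=(d_1,\dots,d_\ell)^T$. Put $L'_{iii}=L_{iii}+\sum_{j\ne i}2L_{ijj}-2b_id_i$. Let $r=2\binom\ell2+3\binom\ell3+\ell$. The columns of $A$ are: ${\bf e}_i-2{\bf e}_k$ for $i\ne k\in[\ell]$; ${\bf e}_i-{\bf e}_j-{\bf e}_k$ for $i,j,k\in[\ell]$ distinct (unordered in $j,k$); and $-{\bf e}_i$ for $i\in[\ell]$. The corresponding entries of ${\bf L}$ (in the same order) are $L_{ikk}$, $2L_{ijk}$, and $L'_{iii}$; all of them are assumed nonzero. For $A=({\bf a}_1\cdots{\bf a}_r)$ and ${\bf c}\in(\mathbb C^* )^r$, $V_{A,{\bf c}}\subset\mathbb P^{r-1}_{\mathbb C}$ is the Zariski closure of the image of $(\mathbb C^* )^\ell\to\mathbb P^{r-1}_{\mathbb C}$, ${\bf x}\mapsto(c_1{\bf x}^{{\bf a}_1}:\dots:c_r{\bf x}^{{\bf a}_r})$; it depends on ${\bf c}$ only up to scale. Write ${\bf x}^A=({\bf x}^{{\bf a}_1},\dots,{\bf x}^{{\bf a}_r})^T$, $u_+=u_1+\dots+u_r$, $p_+=p_1+\dots+p_r$. The critical equations of the maximum likelihood estimation problem on $V_{A,{\bf c}}$ are $u_+\cdot A{\bf p}=p_+\cdot A{\bf u}$, ${\bf p}\in V_{A,{\bf c}}$. Their parametric form is $u_+\,A\operatorname{diag}(\widetilde{\bf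 c})\,{\bf x}^A=A{\bf u}$ in the variables ${\bf x}\in(\mathbb C^* )^\ell$, where $\widetilde{\bf c}=\frac{1}{u_+}{\bf c}$ (so that $V_{A,\widetilde{\bf c}}=V_{A,{\bf c}}$), obtained with ${\bf p}=\operatorname{diag}(\widetilde{\bf c}){\bf x}^A$ and normalization $p_+=1$. *)

(* Defs.v *)
From HB Require Import structures.
From mathcomp Require Import all_boot all_order all_algebra.
From mathcomp Require Import reals.
From mathcomp Require Import complex.
From mathcomp Require Import mpoly.

Set Implicit Arguments.
Unset Strict Implicit.
Unset Printing Implicit Defensive.

Import Order.TTheory GRing.Theory Num.Theory.
Local Open Scope ring_scope.
Local Open Scope complex_scope.

Section ScaledToric.
Variables (C : fieldType) (l r : nat) (A : 'M[int]_(l, r)).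

Definition in_torus (x : 'I_l -> C) : Prop := forall i, x i != 0.

Definition monomials (x : 'I_l -> C) : 'cV[C]_r :=
  \col_(s < r) \prod_(i < l) x i ^ A i s.

Definition toric_param (c : 'cV[C]_r) (x : 'I_l -> C) : 'cV[C]_r :=
  diag_mx c^T *m monomials x.

(* Points of P^(r-1) are represented by nonzero vectors of homogeneous
   coordinates, so the Zariski closure is cut out by homogeneous forms. *)
Definition toric_variety (c : 'cV[C]_r) (p : 'cV[C]_r) : Prop :=
  p != 0 /\
  forall (e : nat) (F : {mpoly C[r]}), F \is e.-homog ->
    (forall x, in_torus x -> F.@[fun s => toric_param c x s 0] = 0) ->
    F.@[fun s => p s 0] = 0.

Definition coord_sum (v : 'cV[C]_r) : C := \sum_(s < r) v s 0.

Definition matA : 'M[C]_(l, r) := map_mx intr A.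

Definition mle_critical (c u p : 'cV[C]_r) : Prop :=
  toric_variety c p /\ coord_sum u *: (matA *m p) = coord_sum p *: (matA *m u).

Definition rescale (u c : 'cV[C]_r) : 'cV[C]_r := (coord_sum u)^-1 *: c.

Definition mle_param_lhs (c u : 'cV[C]_r) (x : 'I_l -> C) : 'cV[C]_l :=
  coord_sum u *: (matA *m diag_mx (rescale u c)^T *m monomials x).

Definition mle_param_rhs (u : 'cV[C]_r) : 'cV[C]_l := matA *m u.

End ScaledToric.

Section Columns.
Variable l : nat.

Definition pair_label : finType := {q : 'I_l * 'I_l | q.1 != q.2}.

(* (i, (j, k)) with i, j, k distinct; j < k makes {j, k} unordered. *)
Definition triple_label : finType :=
  {t : 'I_l * ('I_l * 'I_l) |
    [&& t.1 != t.2.1, t.1 != t.2.2 & (t.2.1 < t.2.2)%N]}.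

Definition label : finType := (pair_label + triple_label + 'I_l)%type.

Definition ncols : nat := 2 * 'C(l, 2) + 3 * 'C(l, 3) + l.

Lemma card_ltn_pairs : #|[pred q : 'I_l * 'I_l | (q.1 < q.2)%N]| = 'C(l, 2).
Proof.
rewrite -sum1_card (eq_bigl (fun q : 'I_l * 'I_l => xpredT q.2 && (q.1 < q.2)%N)) //.
rewrite (reindex (fun q : 'I_l * 'I_l => (q.2, q.1))) /=; last first.
  by exists (fun q => (q.2, q.1)) => [[]|[]].
rewrite -(pair_big_dep xpredT (fun k j : 'I_l => (j < k)%N) (fun _ _ => 1%N)) /=.
rewrite -bin2_sum big_mkord; apply: eq_bigr => k _.
have inj : injective (widen_ord (ltnW (ltn_ord k))).
  by move=> i j /(congr1 val) /= ij; apply: val_inj.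
rewrite sum1_card -[RHS]card_ord -(card_image inj).
apply: eq_card => j; apply/idP/imageP => [jk|[i _ ->]].
  by exists (Ordinal (jk : (j < k)%N)) => //; apply: val_inj.
exact: (ltn_ord i).
Qed.

Lemma card_label : #|{: label}| = ncols.
Proof.
rewrite !card_sum card_ord !card_sig /ncols; congr (_ + _ + _)%N.
- have := cardC [pred q : 'I_l * 'I_l | q.1 == q.2].
  have -> : #|[pred q : 'I_l * 'I_l | q.1 == q.2]| = l.
    rewrite -[RHS]card_ord -(@card_image _ _ (fun i : 'I_l => (i, i))); last by move=> i j [].
    apply: eq_card => -[i j]; rewrite inE /=; apply/eqP/imageP => [->|[k _ [-> ->]] //].
    by exists j.
  rewrite card_prod card_ord => e.
  have := mul_bin_left l 1; rewrite bin1 mulnBl mul1n => ->.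
  by rewrite -e addKn; apply: eq_card => q; rewrite !inE.
- rewrite (mul_bin_left l 2) mulnC -card_ltn_pairs -sum_nat_const -sum1_card.
  rewrite (reindex (fun t : ('I_l * 'I_l) * 'I_l => (t.2, t.1))) /=; last first.
    by exists (fun t => (t.2, t.1)) => [[]|[]].
  rewrite (eq_bigl (fun t : ('I_l * 'I_l) * 'I_l => (t.1.1 < t.1.2)%N &&
      ((t.2 != t.1.1) && (t.2 != t.1.2)))); last first.
    by move=> [[j k] i] /=; rewrite !inE /= andbA andbC.
  rewrite -(pair_big_dep (fun q : 'I_l * 'I_l => (q.1 < q.2)%N)
    (fun q i => (i != q.1) && (i != q.2)) (fun _ _ => 1%N)) /=.
  apply: eq_bigr => -[j k] jk; rewrite sum1_card.
  have := cardsC [set j; k]; rewrite card_ord cards2.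
  have -> : j != k by rewrite neq_ltn [(j < k)%N]jk.
  move=> e; rewrite -[X in (X - 2)%N]e addKn; apply: eq_card => i.
  by rewrite !inE negb_or.
Qed.

Definition label_of (s : 'I_ncols) : label :=
  enum_val (cast_ord (esym card_label) s).

Definition unit_vec (i : 'I_l) : 'cV[int]_l := delta_mx i 0.

Definition column (t : label) : 'cV[int]_l :=
  match t with
  | inl (inl q) => let: (i, k) := val q in unit_vec i - 2 *: unit_vec k
  | inl (inr q) =>
      let: (i, (j, k)) := val q in unit_vec i - unit_vec j - unit_vec k
  | inr i => - unit_vec i
  end.

Definition einstein_A : 'M[int]_(l, ncols) :=
  \matrix_(i, s) column (label_of s) i 0.

End Columns.

Section Einstein.
Variables (R : realType) (l : nat).
Variables (d b : 'I_l -> R) (L : 'I_l -> 'I_l -> 'I_l -> R[i]).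

Definition L' (i : 'I_l) : R[i] :=
  L i i i + \sum_(j < l | j != i) 2 * L i j j - 2 * (b i)%:C * (d i)%:C.

Definition coefficient (t : label l) : R[i] :=
  match t with
  | inl (inl q) => let: (i, k) := val q in L i k k
  | inl (inr q) => let: (i, (j, k)) := val q in 2 * L i j k
  | inr i => L' i
  end.

Definition einstein_L : 'cV[R[i]]_(ncols l) :=
  \col_s coefficient (label_of s).

Definition einstein (x : 'I_l -> R[i]) (i : 'I_l) : R[i] :=
  L' i / x i
  + \sum_(k < l | k != i)
      (2 * L i i k * x k / x i ^+ 2 - L i k k * x i / x k ^+ 2)
  + \sum_(j < l | j != i) \sum_(k < l | (k != i) && (j < k)%N)
      2 * L i j k * (x k / (x i * x j) + x j / (x i * x k) - x i / (x j * x k))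
  + 4 * (d i)%:C.

End Einstein.

(* Main.v *)
(** Row [i] of [A diag(L) x^A] is, monomial by monomial, the non-constant part
    of the [i]-th Einstein equation with the opposite sign, so it suffices to
    solve [A u = 4 d], which the columns [-e_i] do directly.  Every column of
    [A] has coordinate sum [-1], whence [u_+ = -4 (d_1 + ... + d_l) < 0], and
    adding up the equations of the parametric system gives [p_+ = 1]. *)
Require Import Defs.
From mathcomp Require Import all_boot all_order all_algebra.
From mathcomp Require Import reals complex.
From mathcomp Require Import mpoly ring.
Import Order.TTheory GRing.Theory Num.Theory.
Local Open Scope ring_scope.
Local Open Scope complex_scope.

(** * Sums over subtypes and against indicators *)

Lemma sum_sig (V : nmodType) (T : finType) (P : pred T) (F : T -> V) :
  \sum_(q : {x | P x}) F (val q) = \sum_(x | P x) F x.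
Proof.
rewrite [RHS](reindex_omap (op := +%R) (val : {x | P x} -> T) insub) => [|x Px].
  by apply: eq_bigl => q; rewrite (valP q) valK eqxx.
by case: insubP => [q _ /= ->|]; rewrite ?Px.
Qed.

Lemma sum_indicator (K : pzRingType) (I : finType) (P : pred I) (i : I)
    (F : I -> K) :
  \sum_(a | P a) (i == a)%:R * F a = if P i then F i else 0.
Proof.
rewrite big_mkcond (bigD1 i) //= eqxx mul1r big1 ?addr0 // => a ai.
by rewrite eq_sym (negPf ai) mul0r if_same.
Qed.

(** * Laurent monomials on the torus *)

Section LaurentMonomials.
Variables (C : fieldType) (l : nat) (x : 'I_l -> C).
Hypothesis x_neq0 : in_torus x.

(** With the exponent vector as argument this is a homomorphism, so a column of the matrix can be
    evaluated one unit vector at a time. *)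
Definition laurent (v : 'cV[int]_l) : C := \prod_i x i ^ v i 0.

Lemma laurentD v w : laurent (v + w) = laurent v * laurent w.
Proof.
by rewrite -big_split; apply: eq_bigr => i _; rewrite mxE expfzDr ?x_neq0.
Qed.

Lemma laurentN v : laurent (- v) = (laurent v)^-1.
Proof. by rewrite -prodfV; apply: eq_bigr => i _; rewrite mxE invr_expz. Qed.

Lemma laurent_unit_vec i : laurent (unit_vec i) = x i.
Proof.
rewrite /laurent (bigD1 i) //= mxE !eqxx expr1z big1 ?mulr1 // => j ji.
by rewrite mxE (negPf ji).
Qed.

End LaurentMonomials.

Arguments laurent {C l}.

(** * Critical equations on a scaled toric variety *)

Section ScaledToricVariety.
Variables (C : fieldType) (l r : nat) (A : 'M[int]_(l, r)).

(** Each monomial contributes [a] to the power of its degree, which is [e] throughout the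
    support. *)
Lemma mevalZ_dhomog e (F : {mpoly C[r]}) (a : C) (v : 'I_r -> C) :
  F \is e.-homog -> F.@[fun s => a * v s] = a ^+ e * F.@[v].
Proof.
move=> /dhomogP homF; rewrite !mevalE mulr_sumr; apply: eq_big_seq => m mF.
rewrite mulrCA; congr (_ * _).
under eq_bigr do rewrite exprMn.
by rewrite big_split /= prodrXr -mdegE (homF m mF).
Qed.

Lemma toric_paramZ a (c : 'cV[C]_r) x :
  toric_param A (a *: c) x = a *: toric_param A c x.
Proof. by rewrite /toric_param linearZ /= linearZ /= scalemxAl. Qed.

(** Scaling [c] scales the image point, and the vanishing of a form is invariant under scaling. *)
Lemma toric_variety_param (c : 'cV[C]_r) a x :
  in_torus x -> toric_param A (a *: c) x != 0 ->
  toric_variety A c (toric_param A (a *: c) x).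
Proof.
move=> x0 p0; split=> // e F homF vanF.
rewrite -[RHS](mulr0 (a ^+ e)) -(vanF x x0) -(mevalZ_dhomog _ _ _ _ homF).
by apply: meval_eq => s; rewrite toric_paramZ mxE.
Qed.

Lemma matA_toric_paramE (c : 'cV[C]_r) x i :
  (matA C A *m toric_param A c x) i 0
  = \sum_s (A i s)%:~R * (c s 0 * monomials A x s 0).
Proof.
rewrite mxE; apply: eq_bigr => s _.
by rewrite mxE /toric_param mul_diag_mx !mxE.
Qed.

(** The factor $1/u_+$ in [rescale] cancels the prefactor $u_+$. *)
Lemma mle_param_lhsE (c u : 'cV[C]_r) x :
  coord_sum u != 0 -> mle_param_lhs A c u x = matA C A *m toric_param A c x.
Proof.
move=> u0; rewrite /mle_param_lhs -mulmxA -/(toric_param _ _ _) toric_paramZ.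
by rewrite -scalemxAr scalerA mulfV ?scale1r.
Qed.

(** Constant column sums mean that the all-ones row vector times $A$ is a multiple of the all-ones
    vector; this lets $v_+$ be read off from $Av$. *)
Lemma coord_sum_matA a (v : 'cV[C]_r) :
  (forall s, \sum_i A i s = a) ->
  \sum_i (matA C A *m v) i 0 = a%:~R * coord_sum v.
Proof.
move=> colA; under eq_bigr do rewrite mxE.
rewrite exchange_big mulr_sumr /=; apply: eq_bigr => s _.
rewrite -mulr_suml -(colA s) rmorph_sum.
by congr (_ * _); apply: eq_bigr => i _; rewrite mxE.
Qed.

(** Summing the rows of the parametric system gives $a u_+ p_+ = a u_+$, hence $p_+ = 1$. Under this
    normalization the two systems coincide. *)
Lemma mle_param_criticalP a (c u : 'cV[C]_r) x :
  (forall s, \sum_i A i s = a) -> a%:~R != 0 :> C ->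
  coord_sum u != 0 -> in_torus x ->
  let p := toric_param A (rescale u c) x in
  mle_param_lhs A c u x = mle_param_rhs A u <->
  coord_sum p = 1 /\ mle_critical A c u p.
Proof.
move=> colA a0 u0 x0 p.
rewrite /mle_param_rhs /mle_param_lhs -mulmxA -/(toric_param _ _ _) -/p.
split=> [eq_p|[p1 [_ ->]]]; last by rewrite p1 scale1r.
have p1 : coord_sum p = 1.
  apply: (mulfI u0); apply: (mulfI a0); rewrite mulr1.
  rewrite -(coord_sum_matA _ _ colA) -eq_p mulrCA -(coord_sum_matA _ _ colA).
  by rewrite mulr_sumr; apply: eq_bigr => i _; rewrite [RHS]mxE.
split=> //; split; last by rewrite p1 scale1r.
(* Since $p_+ = 1$, [p] is nonzero and represents a projective point. *)
apply: toric_variety_param => //; apply: contra_eq_neq p1 => p0.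
rewrite -/(rescale u c) -/p in p0.
rewrite p0 /coord_sum big1 => [|s _]; last by rewrite mxE.
by rewrite eq_sym oner_neq0.
Qed.

End ScaledToricVariety.

(** * Columns of the Einstein matrix *)

Section EinsteinColumns.
Variable l : nat.

Lemma sum_label_of (V : nmodType) (F : label l -> V) :
  \sum_s F (label_of s) = \sum_t F t.
Proof.
rewrite [RHS](reindex (@label_of l)) //=.
apply: onW_bij; apply: bij_comp; first exact: enum_val_bij.
by exists (cast_ord (card_label l)); [apply: cast_ordKV|apply: cast_ordK].
Qed.

(** [G] and [H] are defined on all index tuples, so sums over subtypes become nested sums over plain
    indices with the side conditions as predicates. *)
Lemma sum_label (V : nmodType) (F : label l -> V)
    (G : 'I_l -> 'I_l -> V) (H : 'I_l -> 'I_l -> 'I_l -> V) :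
  (forall q, F (inl (inl q)) = G (val q).1 (val q).2) ->
  (forall q, F (inl (inr q)) = H (val q).1 (val q).2.1 (val q).2.2) ->
  \sum_t F t =
    \sum_a \sum_(k | a != k) G a k +
    \sum_a \sum_(j : 'I_l) \sum_(k : 'I_l | [&& a != j, a != k & (j < k)%N])
      H a j k +
    \sum_a F (inr a).
Proof.
move=> FG FH; rewrite !big_sumType /=; congr (_ + _ + _).
  under eq_bigr do rewrite FG.
  rewrite (sum_sig _ _ _ (fun q => G q.1 q.2)).
  by rewrite (pair_big_dep xpredT (fun a k : 'I_l => a != k)).
under eq_bigr do rewrite FH.
rewrite (sum_sig _ _ _ (fun t => H t.1 t.2.1 t.2.2)).
under [RHS]eq_bigr do rewrite pair_big_dep /=.
by rewrite pair_big_dep /=; apply: eq_bigl => -[a [j k]].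
Qed.

Lemma sum_unit_vec (i : 'I_l) : \sum_j unit_vec i j 0 = 1.
Proof.
rewrite (bigD1 i) //= mxE !eqxx big1 ?addr0 // => j ji.
by rewrite mxE (negPf ji).
Qed.

Lemma sum_column (t : label l) : \sum_i column t i 0 = -1.
Proof.
have sD (v w : 'cV[int]_l) :
    \sum_i (v + w) i 0 = \sum_i v i 0 + \sum_i w i 0.
  by rewrite -big_split; apply: eq_bigr => i _; rewrite mxE.
have sN (v : 'cV[int]_l) : \sum_i (- v) i 0 = - \sum_i v i 0.
  by rewrite -sumrN; apply: eq_bigr => i _; rewrite mxE.
(* Twice a unit vector is written as a sum of two, so additivity settles all three column types. *)
case: t => [[[[i k] ?]|[[i [j k]] ?]]|i];
  by rewrite /= ?scaler_nat ?mulr2n !(sD, sN) !sum_unit_vec.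
Qed.

Lemma sum_einstein_A s : \sum_i einstein_A l i s = -1.
Proof. by under eq_bigr do rewrite mxE; apply: sum_column. Qed.

Lemma monomials_einstein_A (C : fieldType) (x : 'I_l -> C) s :
  monomials (einstein_A l) x s 0 = laurent x (column (label_of s)).
Proof. by rewrite mxE; apply: eq_bigr => i _; rewrite mxE. Qed.

End EinsteinColumns.

(** * Collecting the columns that meet a given row *)

Section EinsteinExpansion.
Variable l : nat.
Variable K : pzRingType.

(** The coefficient is coordinate [i] of $e_a - 2e_k$, so only columns with [i] as one of the two
    indices survive. *)
Lemma sum_pairs (i : 'I_l) (g : 'I_l -> 'I_l -> K) :
  \sum_a \sum_(k | a != k) ((i == a)%:R - 2 * (i == k)%:R) * g a k
  = \sum_(k | k != i) (g i k - 2 * g k i).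
Proof.
rewrite sumrB -[in RHS]mulr_sumr.
transitivity (\sum_a (i == a)%:R * (\sum_(k | a != k) g a k)
              - 2 * \sum_a \sum_(k | a != k) (i == k)%:R * g a k).
  rewrite mulr_sumr -sumrB; apply: eq_bigr => a _.
  by rewrite !mulr_sumr -sumrB; apply: eq_bigr => k _; rewrite mulrBl mulrA.
rewrite sum_indicator /=; congr (_ - 2 * _).
  by apply: eq_bigl => k; rewrite eq_sym.
rewrite [RHS]big_mkcond; apply: eq_bigr => a _.
by rewrite (sum_indicator _ _ _ _ (g a)).
Qed.

(** The coefficient is coordinate [i] of $e_a - e_j - e_k$. As $j < k$, the index [i] may occupy
    either negative slot; the symmetry of [h] moves it to the first. *)
Lemma sum_triples (i : 'I_l) (h : 'I_l -> 'I_l -> 'I_l -> K) :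
  (forall a j k, h a j k = h a k j) ->
  \sum_a \sum_(j : 'I_l) \sum_(k : 'I_l | [&& a != j, a != k & (j < k)%N])
    ((i == a)%:R - (i == j)%:R - (i == k)%:R) * h a j k
  = \sum_(j | j != i) \sum_(k | (k != i) && (j < k)%N)
      (h i j k - (h j i k + h k i j)).
Proof.
move=> hC.
pose P a j k := [&& a != j, a != k & ((j : 'I_l) < (k : 'I_l))%N].
transitivity (\sum_a (i == a)%:R * (\sum_j \sum_(k | P a j k) h a j k)
              - (\sum_a \sum_j (i == j)%:R * (\sum_(k | P a j k) h a j k)
                 + \sum_a \sum_j \sum_(k | P a j k) (i == k)%:R * h a j k)).
  rewrite -big_split -sumrB; apply: eq_bigr => a _ /=.
  rewrite -big_split mulr_sumr -sumrB; apply: eq_bigr => j _ /=.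
  rewrite !mulr_sumr -big_split -sumrB; apply: eq_bigr => k _ /=.
  by rewrite !mulrBl opprD addrA.
rewrite sum_indicator /=.
under [RHS]eq_bigr do rewrite sumrB.
rewrite sumrB; congr (_ - _).
  rewrite [RHS]big_mkcond; apply: eq_bigr => j _.
  case: (eqVneq j i) => [->|ji].
    by rewrite big_pred0 // => k; rewrite /P eqxx.
  by apply: eq_bigl => k; rewrite /P ![i == _]eq_sym ji.
under [RHS]eq_bigr do rewrite big_split /=.
(* After the exchange, the first argument of [h] is the outer index in both halves. *)
rewrite big_split /= [X in _ = _ + X](exchange_big_dep (fun k => k != i)) /=;
  last by move=> j k _ /andP[].
rewrite -!big_split /= [RHS]big_mkcond; apply: eq_bigr => a _.
rewrite sum_indicator /=.
under [X in _ + X]eq_bigr => j _ do rewrite (sum_indicator _ _ _ _ (h a j)).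
rewrite /P; case: (eqVneq a i) => [_|ai] /=.
  rewrite big_pred0_eq add0r.
  by apply: big1 => j _; rewrite andbF.
rewrite big_mkcond [X in _ = X + _]big_mkcond [X in _ = _ + X]big_mkcond.
rewrite -!big_split; apply: eq_bigr => k _ /=.
(* Each [k] other than [i] and [a] contributes [h a i k] once to both sides: the left splits by the
   order of [i] and [k], the right by that of [a] and [k]. *)
rewrite (hC a k i) -!(inj_eq val_inj) /=.
by case: (ltngtP i k); case: (ltngtP a k); rewrite ?addr0 ?add0r.
Qed.

End EinsteinExpansion.

(** * From matrix rows to Einstein equations *)

Lemma matA_einsteinE (R : realType) (l : nat) (d b : 'I_l -> R)
    (L : 'I_l -> 'I_l -> 'I_l -> R[i]) (x : 'I_l -> R[i]) (i : 'I_l) :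
  (forall i j k : 'I_l, L i j k = L j i k) ->
  (forall i j k : 'I_l, L i j k = L i k j) ->
  in_torus x ->
  (matA R[i] (einstein_A l) *m toric_param (einstein_A l) (einstein_L d b L) x)
    i 0 = 4 * (d i)%:C - einstein d b L x i.
Proof.
move=> L12 L23 x0; rewrite matA_toric_paramE.
pose F t := (column t i 0)%:~R
            * (coefficient d b L t * laurent x (column t)) : R[i].
transitivity (\sum_s F (label_of s)).
  by apply: eq_bigr => s _; rewrite monomials_einstein_A !mxE.
(* [g] and [h] are the coefficients times the monomials of the columns $e_a - 2e_k$ and $e_a - e_j -
   e_k$. *)
pose g a k := L a k k * (x a / x k ^+ 2).
pose h a j k := 2 * L a j k * (x a / (x j * x k)).
have hC a j k : h a j k = h a k j by rewrite /h L23 (mulrC (x j)).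
rewrite sum_label_of (sum_label _ _ _
  (fun a k => ((i == a)%:R - 2 * (i == k)%:R) * g a k)
  (fun a j k => ((i == a)%:R - (i == j)%:R - (i == k)%:R) * h a j k)).
- rewrite sum_pairs sum_triples //.
  have -> : \sum_a F (inr a) = - (L' d b L i / x i).
    transitivity (\sum_a (i == a)%:R * - (L' d b L a / x a)).
      apply: eq_bigr => a _; rewrite /F /= laurentN // laurent_unit_vec // !mxE.
      by rewrite eqxx andbT rmorphN rmorph_nat mulNr mulrN.
    by rewrite sum_indicator.
  (* The constants $4d_i$ cancel; the three remaining groups match up to the symmetry of [L]. *)
  rewrite /einstein opprD addrCA subrr addr0 !opprD addrC addrA -!sumrN.
  congr (_ + _ + _).
    apply: eq_bigr => k _; rewrite /g opprB (L23 i i k) (L12 i k i).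
    by rewrite !mulrA.
  apply: eq_bigr => j _; rewrite -sumrN; apply: eq_bigr => k _.
  rewrite /h (L12 j i k) (L12 k i j) (L23 i k j).
  ring.
- case=> [[a k] ak]; rewrite /F /g /= !mxE !eqxx !andbT; congr (_ * (_ * _)).
    by rewrite rmorphB rmorphM !rmorph_nat.
  rewrite laurentD // laurentN scaler_nat mulr2n laurentD //.
  by rewrite !laurent_unit_vec expr2.
- case=> [[a [j k]] ajk]; rewrite /F /h /= !mxE !eqxx !andbT.
  congr (_ * (_ * _)); first by rewrite !rmorphB !rmorph_nat.
  by rewrite !laurentD // !laurentN !laurent_unit_vec invfM mulrA.
Qed.

Theorem theorem4p2 (R : realType) (l : nat) (hl : (2 <= l)%N)
  (d b : 'I_l -> R) (hd : forall i : 'I_l, 0 < d i)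
  (L : 'I_l -> 'I_l -> 'I_l -> R[i])
  (Lsym12 : forall i j k : 'I_l, L i j k = L j i k)
  (Lsym23 : forall i j k : 'I_l, L i j k = L i k j)
  (Lneq0 : forall s : 'I_(ncols l), einstein_L d b L s 0 != 0) :
  exists u : 'cV[R]_(ncols l),
    let uC : 'cV[R[i]]_(ncols l) := map_mx (real_complex R) u in
    [/\ coord_sum uC != 0,
        (* the two systems agree equation by equation *)
        forall x : 'I_l -> R[i], in_torus x -> forall i : 'I_l,
          einstein d b L x i
          = (mle_param_rhs (einstein_A l) uC
             - mle_param_lhs (einstein_A l) (einstein_L d b L) uC x) i 0
      & (* hence x solves the Einstein equations iff its image solves the
           critical equations on the scaled toric variety, with p_+ = 1 *)
        forall x : 'I_l -> R[i], in_torus x ->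
          let p := toric_param (einstein_A l)
                     (rescale uC (einstein_L d b L)) x in
          (forall i : 'I_l, einstein d b L x i = 0) <->
          (coord_sum p = 1 /\
           mle_critical (einstein_A l) (einstein_L d b L) uC p)].
Proof.
(* The entry $-4d_i$ on the column $-e_i$ contributes $4d_i$ to row [i] and nothing to the other
   rows. *)
pose c s : R := if label_of s is inr i then - (4 * d i) else 0.
pose uC : 'cV[R[i]]_(ncols l) := map_mx (real_complex R) (\col_s c s).
exists (\col_s c s) => /=; rewrite -/uC.
have Au i : mle_param_rhs (einstein_A l) uC i 0 = 4 * (d i)%:C.
  rewrite mxE.
  pose F t : R[i] := (column t i 0)%:~R *
    (if t is inr k then - (4 * d k) else 0)%:C.
  transitivity (\sum_s F (label_of s)).
    by apply: eq_bigr => s _; rewrite !mxE.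
  rewrite sum_label_of big_sumType big1 /= ?add0r; last first.
    by case=> q _; rewrite /F mulr0.
  transitivity (\sum_k (i == k)%:R * (4 * (d k)%:C)); last first.
    by rewrite sum_indicator.
  apply: eq_bigr => k _; rewrite /F /= !mxE eqxx andbT !rmorphN rmorph_nat.
  by rewrite mulrNN rmorphM rmorph_nat.
have u0 : coord_sum uC != 0.
  (* All column sums are $-1$, so adding the rows of $Au = 4d$ gives $-u_+$, which is positive
     because every $d_i$ is and the index set is nonempty. *)
  have: - coord_sum uC = (4 * \sum_i d i)%:C.
    rewrite -mulN1r -(rmorphN1 (intmul 1)).
    rewrite -(coord_sum_matA _ _ _ (einstein_A l)); last exact: sum_einstein_A.
    rewrite rmorphM rmorph_nat rmorph_sum mulr_sumr.
    by apply: eq_bigr => i _; apply: Au.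
  apply: contra_eq_neq => ->; rewrite oppr0 eq_sym.
  rewrite (fmorph_eq0 (real_complex R)) mulf_neq0 ?pnatr_eq0 // psumr_neq0.
    by apply/hasP; exists (Ordinal (ltnW hl)); rewrite ?mem_index_enum /= ?hd.
  by move=> i _; apply: ltW.
have eqE x : in_torus x -> forall i, einstein d b L x i =
    (mle_param_rhs (einstein_A l) uC
     - mle_param_lhs (einstein_A l) (einstein_L d b L) uC x) i 0.
  move=> x0 i; rewrite mle_param_lhsE // mxE Au mxE.
  by rewrite matA_einsteinE // opprB addrC subrK.
split=> // x x0; rewrite /=.
apply: (iff_trans _ (mle_param_criticalP _ _ _ _ (-1) _ _ _ _ _ u0 x0));
  [|exact: sum_einstein_A|by rewrite rmorphN1 oppr_eq0 oner_neq0].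
split=> [e0|e i]; last by rewrite eqE // e subrr mxE.
apply/esym/eqP; rewrite -subr_eq0; apply/eqP/colP => i.
by rewrite -eqE // e0 mxE.
Qed.
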